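(* Let $V\subseteq F_\infty$ be any non-trivial word set. Then there exist a 2-generator group $G$, a full order relation on $G$, and an embedding (injective homomorphism) $\Phi:\mathbb{Q}\to G$ of the additive group of rational numbers $\mathbb{Q}$ (fully ordered by its natural order) into $G$ such that $\Phi$ is order-preserving, subnormal, and $V$-verbal, i.e. $\Phi(\mathbb{Q})\subseteq V(G)$.
   Context: $F_\infty$ denotes the free group of countably infinite rank; a word set is a subset $V\subseteq F_\infty$. For a group $G$, the $V$-verbal subgroup $V(G)$ is the subgroup generated by all values $v(g_1,\dots,g_n)\in G$ for all words $v(x_1,\dots,x_n)\in V$ and all $g_1,\dots,g_n\in G$. The word set $V$ is non-trivial if $V(F_\infty)\neq\{1\}$. An embedding of a group $H$ into a group $G$ is $V$-verbal if the image of $H$ lies in $V(G)$. A group $G$ is fully ordered if a linear (total) order relation $<$ is defined on $G$ such that for all $g_1,g_2\in G$, $g_1<g_2$ implies $g_1x<g_2x$ and $xg_1<xg_2$ for every $x\in G$; such a relation is called a full order relation on $G$. An embedding $\varphi$ of a fully ordered group $H$ into a fully ordered group $G$ is order-preserving if for all $h_1,h_2\in H$: $h_1<h_2$ in $H$ if and only if $\varphi(h_1)<\varphi(h_2)$ in $G$. An embedding $\varphi:H\to G$ is subnormal if $\varphi(H)$ is a subnormal subgroup of $G$, i.e. there is a finite series of subgroups $\varphi(H)=G_0\le G_1\le\dots\le G_n=G$ with $G_{i-1}$ normal in $G_i$ for every $i=1,\dots,n$. A 2-generator group is a group generated by two elements. *)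

(* Defs.v *)
From HB Require Import structures.
From mathcomp Require Import all_boot all_order all_algebra.
From mathcomp Require Import all_classical.

Set Implicit Arguments.
Unset Strict Implicit.
Unset Printing Implicit Defensive.

Import Order.TTheory GRing.Theory Num.Theory.

Local Open Scope classical_set_scope.
Local Open Scope group_scope.

(* The letter (i, false) stands for the free generator x_i, and (i, true) for
   its inverse. *)
Definition letter : Type := (nat * bool)%type.

Definition flip (a : letter) : letter := (a.1, ~~ a.2).

Definition reduced (w : seq letter) : bool :=
  sorted (fun a b : letter => b != flip a) w.

(* The free group of countably infinite rank, as the group of reduced words. *)
Record free_inf := FreeInf {
  freeval :> seq letter;
  _ : reduced freeval }.

HB.instance Definition _ := [isSub for freeval].
HB.instance Definition _ := [Choice of free_inf by <:].

Definition push (a : letter) (w : seq letter) : seq letter :=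
  if w is b :: w' then if b == flip a then w' else a :: w else [:: a].

(* The reduced form of u ++ w, when w is reduced. *)
Definition cat_red (u w : seq letter) : seq letter := foldr push w u.

Definition inv_word (u : seq letter) : seq letter := rev (map flip u).

Lemma flipK : involutive flip.
Proof. by case=> i b; rewrite /flip /= negbK. Qed.

Lemma reduced_behead a w : reduced (a :: w) -> reduced w.
Proof. exact: path_sorted. Qed.

Lemma push_reduced a w : reduced w -> reduced (push a w).
Proof.
case: w => [//|b w] rw /=; case: eqP => [_|/eqP nba].
  exact: reduced_behead rw.
by rewrite /reduced /= nba.
Qed.

Lemma push_cons a w : reduced (a :: w) -> push a w = a :: w.
Proof. by case: w => [//|b w] /= /andP[/negPf-> _]. Qed.

Lemma pushK a w : reduced w -> push (flip a) (push a w) = w.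
Proof.
case: w => [|b w] rw /=; first by rewrite flipK eqxx.
case: eqP => [eb|_]; last by rewrite /= flipK eqxx.
by rewrite -eb push_cons.
Qed.

Lemma cat_red_reduced u w : reduced w -> reduced (cat_red u w).
Proof. by move=> rw; elim: u => //= a u; apply: push_reduced. Qed.

Lemma cat_red_push a v w :
  reduced w -> cat_red (push a v) w = push a (cat_red v w).
Proof.
case: v => [//|b v] rw /=; case: eqP => [->|//].
by rewrite -{1}[a]flipK pushK // cat_red_reduced.
Qed.

Lemma cat_redA u v w :
  reduced w -> cat_red u (cat_red v w) = cat_red (cat_red u v) w.
Proof. by move=> rw; elim: u => //= a u ->; rewrite cat_red_push. Qed.

Lemma cat_red0 u : reduced u -> cat_red u [::] = u.
Proof.
elim: u => //= a u IH rau.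
by rewrite IH ?push_cons //; apply: reduced_behead rau.
Qed.

Lemma inv_wordK : involutive inv_word.
Proof. by move=> u; rewrite /inv_word map_rev revK (mapK flipK). Qed.

Lemma inv_word_reduced u : reduced u -> reduced (inv_word u).
Proof.
rewrite /reduced /inv_word rev_sorted sorted_map; congr is_true.
apply: eq_sorted => -[i b] [j c]; rewrite /flip /= !xpair_eqE /=.
by rewrite [j == i]eq_sym; case: b c => [] [].
Qed.

Lemma cat_redV u w : reduced w -> cat_red (inv_word u) (cat_red u w) = w.
Proof.
move=> rw; elim: u => //= a u IH.
rewrite /inv_word /= rev_cons /cat_red foldr_rcons pushK //.
exact: cat_red_reduced.
Qed.

Definition free_one : free_inf := @FreeInf [::] isT.

Definition free_mul (u v : free_inf) : free_inf :=
  FreeInf (cat_red_reduced u (valP v)).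

Definition free_inv (u : free_inf) : free_inf :=
  FreeInf (inv_word_reduced (valP u)).

Lemma free_mulA : associative free_mul.
Proof. by move=> u v w; apply/val_inj/cat_redA/(valP w). Qed.

Lemma free_mul1 : left_id free_one free_mul.
Proof. by move=> u; apply: val_inj. Qed.

Lemma free_mulr1 : right_id free_one free_mul.
Proof. by move=> u; apply/val_inj/cat_red0/(valP u). Qed.

Lemma free_mulV : left_inverse free_one free_inv free_mul.
Proof.
move=> u; apply/val_inj => /=.
by rewrite -[X in cat_red _ X](cat_red0 (valP u)) cat_redV.
Qed.

Lemma free_mulrV : right_inverse free_one free_inv free_mul.
Proof.
move=> u; rewrite -[u in free_mul u _](_ : free_inv (free_inv u) = u).
  exact: free_mulV.
exact/val_inj/inv_wordK.
Qed.

HB.instance Definition _ := isGroup.Build free_inf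
  free_mulA free_mul1 free_mulr1 free_mulV free_mulrV.

Section Groups.

Variable G : groupType.
Implicit Types (A H K : set G) (lt : rel G).

Definition letter_value (g : nat -> G) (a : letter) : G :=
  if a.2 then (g a.1)^-1 else g a.1.

(* The value v(g_0, g_1, ...); it depends only on the g_i such that x_i occurs
   in v, so that no bound on the number of variables is needed. *)
Definition word_value (g : nat -> G) (v : free_inf) : G :=
  \prod_(a <- freeval v) letter_value g a.

Definition subgroup H : Prop := group_closed (mem H).

Definition generated A : set G := smallest subgroup A.

Definition two_generator : Prop :=
  exists a b : G, generated [set a; b] = [set: G].

Definition verbal (V : set free_inf) : set G :=
  generated [set z | exists2 v, V v & exists g : nat -> G, z = word_value g v].

Definition normal_in H K : Prop :=
  [/\ subgroup H, subgroup K, H `<=` K &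
      forall h k, H h -> K k -> H (h ^ k)].

Definition subnormal H : Prop :=
  subgroup H /\
  exists (n : nat) (S : nat -> set G),
    [/\ S 0 = H, S n = [set: G] &
        forall i, (i < n)%N -> normal_in (S i) (S i.+1)].

Definition full_order lt : Prop :=
  [/\ irreflexive lt, transitive lt,
      forall x y, [\/ lt x y, x = y | lt y x] &
      forall g1 g2 x, lt g1 g2 -> lt (g1 * x) (g2 * x) /\ lt (x * g1) (x * g2)].

End Groups.

Arguments two_generator : clear implicits.
Arguments verbal : clear implicits.

Definition nontrivial_word_set (V : set free_inf) : Prop :=
  verbal free_inf V <> [set 1].

Section Embeddings.

Variables (H G : groupType) (phi : H -> G).

Definition order_preserving (ltH : rel H) (ltG : rel G) : Prop :=
  forall h1 h2, ltH h1 h2 <-> ltG (phi h1) (phi h2).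

Definition subnormal_embedding : Prop := subnormal (range phi).

Definition verbal_embedding (V : set free_inf) : Prop :=
  range phi `<=` verbal G V.

End Embeddings.

(* The additive group of the rationals, in the multiplicative notation shared
   by all groups. *)
Definition ratgroup : groupType := Algebra.to_multiplicative rat.

Definition rat_lt : rel ratgroup := fun p q => ((p : rat) < (q : rat))%R.

Definition free_gen (i : nat) : free_inf := @FreeInf [:: (i, false)] isT.

Lemma word_value_gen (G : groupType) (g : nat -> G) i :
  word_value g (free_gen i) = g i.
Proof. by rewrite /word_value big_seq1. Qed.

Lemma word_valueM (G : groupType) (g : nat -> G) :
  {morph word_value g : u v / u * v}.
Proof.
have pushE a w : \prod_(b <- push a w) letter_value g b =
    letter_value g a * \prod_(b <- w) letter_value g b.
  case: w => [|b w] /=; first by rewrite big_seq1 big_nil mulg1.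
  case: eqP => [->|_]; last by rewrite big_cons.
  rewrite big_cons mulgA /letter_value /=.
  by case: a.2 => /=; rewrite (mulVg, mulgV) mul1g.
move=> [u ru] [v rv]; rewrite /word_value /= {ru rv}.
elim: u => [|a u IH]; first by rewrite big_nil mul1g.
by rewrite /= pushE IH big_cons mulgA.
Qed.

Lemma rat_lt_full : full_order rat_lt.
Proof.
split=> [p|q p r|p q|p q r ltpq]; first exact: (@ltxx _ rat p).
- exact: (@lt_trans _ rat).
- have := @ltgtP _ rat p q; rewrite /rat_lt.
  by case=> h; [apply: Or31|apply: Or33|apply: Or32].
- by split; rewrite /rat_lt; [apply: (ltr_leD ltpq)|apply: (ler_ltD _ ltpq)].
Qed.

(* Main.v *)
(* Let K be the group of unitriangular rational matrices of the least size for
   which some w in V takes a value other than 1 at commutators of elements of K.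
   By minimality such values are central, with a single entry off the diagonal,
   in the corner, and diagonal automorphisms of K make this entry an arbitrary
   nonzero rational.  So Q, as the corner subgroup of K, consists of values of w
   at commutators, and its order is induced by the order of K that compares
   matrices lexicographically, superdiagonal by superdiagonal.

   In the unrestricted wreath product of K with the integers, take G to be
   generated by the shift t and by the base element s that has the entries of an
   enumeration k_0, k_1, ... of K at the positions 2^i, and 1 elsewhere.  The
   differences 2^i - 2^j with i <> j being pairwise distinct, the commutator of
   the conjugates of s by t^(2^i) and t^(2^j) is [k_i, k_j] at position 0.  Hence
   G contains the commutators of K at position 0, and V(G) contains Q there; Q is
   centralised by the base elements of G, which form a normal subgroup.  The
   elements of G have support bounded below, so G is ordered by the shift first,
   then by the first position where two base parts differ. *)

From HB Require Import structures.
Require Import Defs.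
From mathcomp Require Import all_boot all_order all_algebra all_classical.
From mathcomp Require Import zify ring.

Set Implicit Arguments.
Unset Strict Implicit.
Unset Printing Implicit Defensive.

Import Order.TTheory GRing.Theory Num.Theory.

Local Open Scope classical_set_scope.

(** * Values of words *)

Section WordValues.

Local Open Scope group_scope.

Section Morphisms.

Variables (G H : groupType) (f : G -> H) (fM : {morph f : x y / x * y}).

Lemma morphism1 : f 1 = 1.
Proof. by apply: (mulgI (f 1)); rewrite -fM !mulg1. Qed.

Lemma morphismV : {morph f : x / x^-1}.
Proof. by move=> x; apply: (mulgI (f x)); rewrite -fM !mulgV morphism1. Qed.

Lemma morphismR : {morph f : x y / [~ x, y]}.
Proof. by move=> x y; rewrite /commg /conjg !fM !morphismV. Qed.

Lemma morphism_word_value g v : f (word_value g v) = word_value (f \o g) v.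
Proof.
rewrite /word_value (big_morph f fM morphism1); apply: eq_bigr => -[i b] _.
by rewrite /letter_value /=; case: b; rewrite ?morphismV.
Qed.

End Morphisms.

Definition syllable : Type := (letter * nat)%type.

Definition add_letter (a : letter) (ss : seq syllable) : seq syllable :=
  if ss is (b, m) :: ss' then
    if b == a then (b, m.+1) :: ss' else (a, 0) :: ss
  else [:: (a, 0)].

(* The entry (a, m) stands for the syllable a ^ (m + 1). *)
Definition syllables (w : seq letter) : seq syllable :=
  foldr add_letter [::] w.

Definition alternating : seq syllable -> bool :=
  sorted (fun s t : syllable => s.1.1 != t.1.1).

Definition syllable_value (G : groupType) (g : nat -> G) (s : syllable) : G :=
  letter_value g s.1 ^+ s.2.+1.

Lemma prod_syllables (G : groupType) (g : nat -> G) w :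
  \prod_(s <- syllables w) syllable_value g s = \prod_(a <- w) letter_value g a.
Proof.
elim: w => [|a w IH]; first by rewrite !big_nil.
rewrite big_cons -IH /=; case: (syllables w) => [|[b m] ss] /=.
  by rewrite big_seq1 big_nil /syllable_value expg1 mulg1.
case: eqP => [->|_]; rewrite !big_cons /syllable_value /=.
  by rewrite [_ ^+ m.+2]expgS mulgA.
by rewrite expg1.
Qed.

(** Equal neighbouring letters are merged and a reduced word has no letter beside its inverse, so
    neighbouring syllables belong to different generators. *)
Lemma syllables_alternating w : reduced w -> alternating (syllables w).
Proof.
(* The induction also needs that the first syllable carries the first letter. *)
suff: reduced w -> alternating (syllables w) /\
      ohead (map fst (syllables w)) = ohead w by move=> H /H[].
elim: w => // a w IH rw; have [] := IH (reduced_behead rw).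
move: rw; rewrite /= /alternating.
case: w {IH} => [|c w] /=; first by [].
case/andP=> ca _; case: (add_letter c _) => [//|[b m] ss] /=.
case: eqP => [->|/eqP ba] /= altb [bc]; first by split=> //; case: ss altb.
split=> //; rewrite altb andbT bc; apply: contra ca => /eqP ac.
move: ba ac; rewrite bc /flip {bc}.
by case: a => i []; case: c => j [] /= ne ij; rewrite ij eqxx in ne *.
Qed.

Lemma syllables_nil w : syllables w = [::] -> w = [::].
Proof.
by case: w => // a w /=; case: (syllables w) => [|[b m] ss] //=; case: eqP.
Qed.

End WordValues.

(** * Generated subgroups *)

Section GeneratedSubgroups.

Local Open Scope group_scope.
Variable G : groupType.
Implicit Types (A H : set G).

Lemma subgroupP H :
  subgroup H <-> H 1 /\ forall x y, H x -> H y -> H (x / y).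
Proof.
rewrite /subgroup /group_closed /divg_closed.
split=> -[H1 HB]; split=> [|x y Hx Hy]; rewrite ?inE // in H1 *.
  by have := HB x y; rewrite !inE; apply.
by move: Hx Hy; rewrite !inE; apply: HB.
Qed.

Lemma subgroup1 H : subgroup H -> H 1. Proof. by case/subgroupP. Qed.

Lemma subgroupF H x y : subgroup H -> H x -> H y -> H (x / y).
Proof. by case/subgroupP=> _; apply. Qed.

Lemma subgroupV H x : subgroup H -> H x -> H x^-1.
Proof. by move=> sH Hx; rewrite -[x^-1]mul1g; apply: subgroupF (subgroup1 sH) _. Qed.

Lemma subgroupM H x y : subgroup H -> H x -> H y -> H (x * y).
Proof.
by move=> sH Hx Hy; rewrite -[y]invgK; apply: subgroupF => //; apply: subgroupV.
Qed.

Lemma subgroupX H x n : subgroup H -> H x -> H (x ^+ n).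
Proof.
move=> sH Hx; elim: n => [|n IH]; first exact: subgroup1.
by rewrite expgS; apply: subgroupM.
Qed.

Lemma subgroupJ H x y : subgroup H -> H x -> H y -> H (x ^ y).
Proof.
by move=> sH Hx Hy; rewrite conjgE; do !apply: subgroupM => //; apply: subgroupV.
Qed.

Lemma subgroupR H x y : subgroup H -> H x -> H y -> H [~ x, y].
Proof.
move=> sH Hx Hy; rewrite commgEl; apply: subgroupM => //; first exact: subgroupV.
exact: subgroupJ.
Qed.

Lemma generated_subgroup A : subgroup (generated A).
Proof.
apply/subgroupP; split=> [B [sB _]|x y gx gy B [sB AB]]; first exact: subgroup1.
by apply: subgroupF => //; [apply: gx|apply: gy].
Qed.

Lemma sub_generated A : A `<=` generated A.
Proof. by move=> x Ax B [_]; apply. Qed.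

Lemma generated_min A H : subgroup H -> A `<=` H -> generated A `<=` H.
Proof. by move=> sH AH x; apply. Qed.

End GeneratedSubgroups.

(** If every word of [V] were empty, all values would be 1. *)
Lemma nontrivial_word (V : set free_inf) :
  nontrivial_word_set V -> exists2 v, V v & freeval v <> [::].
Proof.
move=> ntV; apply: contrapT => /forall2NP V0; apply: ntV.
apply/seteqP; split; last first.
  by move=> _ ->; apply: subgroup1; apply: generated_subgroup.
apply: generated_min => [|_ [v Vv [g ->]]].
  by apply/subgroupP; split=> // x y -> ->; rewrite divg1.
case: (V0 v) => // /contrapT v0.
by rewrite /= /word_value v0 big_nil.
Qed.

(** * Unitriangular rational matrices *)

Section LexicographicComparison.

Local Open Scope ring_scope.
Variables (T K : Type) (key : T -> int) (lt : rel K).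
Implicit Types f g h : T -> K.

Definition lex f g : Prop :=
  exists k, lt (f k) (g k) /\ forall l, key l < key k -> f l = g l.

Lemma lex_irr f : irreflexive lt -> ~ lex f f.
Proof. by move=> irr [k []]; rewrite irr. Qed.

Lemma lex_trans f g h :
  injective key -> transitive lt -> lex f g -> lex g h -> lex f h.
Proof.
move=> key_inj tr [k [fg fgE]] [l [gh ghE]].
have [kl|lk|/key_inj kl] := ltgtP (key k) (key l).
- exists k; split=> [|m mk]; first by rewrite -ghE.
  by rewrite fgE // ghE // (lt_trans mk).
- exists l; split=> [|m ml]; first by rewrite fgE.
  by rewrite fgE ?ghE // (lt_trans ml).
- exists k; split=> [|m mk]; first by apply: tr fg _; rewrite kl.
  by rewrite fgE // ghE // -kl.
Qed.

(** Keys range over all integers; agreement below [b] provides a least key of disagreement. *)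
Lemma lex_total f g :
    (forall x y, [\/ lt x y, x = y | lt y x]) ->
    (exists b, forall l, key l < b -> f l = g l) ->
  [\/ lex f g, f = g | lex g f].
Proof.
move=> total [b fgb].
pose P (n : nat) := `[< exists k, key k = b + n%:Z /\ f k <> g k >].
have [exP|nP] := pselect (exists n, P n); last first.
  apply: Or32; apply/funext => k; apply: contrapT => fgk; apply: nP.
  exists `|key k - b|%N; apply/asboolP; exists k; split=> //.
  have : b <= key k by rewrite leNgt; apply/negP => /fgb.
  lia.
case: (ex_minnP exP) => n /asboolP [k [kE fgk]] minn.
have fgE l : key l < key k -> f l = g l.
  move=> lk; have [/fgb //|bl] := ltP (key l) b.
  apply: contrapT => fgl; have /minn : P `|key l - b|%N.
    by apply/asboolP; exists l; split=> //; lia.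
  lia.
case: (total (f k) (g k)) => // fg; [apply: Or31|apply: Or33]; exists k => //.
by split=> // l /fgE.
Qed.

End LexicographicComparison.

(** * The ordered group of unitriangular matrices *)

Section UnitriangularMatrices.

Local Open Scope ring_scope.

Definition unitri n (A : 'M[rat]_n) : bool :=
  [forall i : 'I_n, forall j : 'I_n, (j <= i)%N ==> (A i j == (i == j)%:R)].

Lemma unitriP n (A : 'M[rat]_n) :
  reflect (forall i j : 'I_n, (j <= i)%N -> A i j = (i == j)%:R) (unitri A).
Proof.
apply: (iffP forallP) => H i; last by apply/forallP => j; apply/implyP => /H->.
by move=> j ji; have /forallP/(_ j)/implyP/(_ ji)/eqP := H i.
Qed.

Record utmx n := UTMatrix { utval :> 'M[rat]_n; _ : unitri utval }.

HB.instance Definition _ n := [isSub for @utval n].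
HB.instance Definition _ n := [Countable of utmx n by <:].

Variable n : nat.
Implicit Types A B C : utmx n.

Lemma utmxE A (i j : 'I_n) : (j <= i)%N -> A i j = (i == j)%:R.
Proof. exact: (unitriP _ (valP A)). Qed.

Lemma utmx_diag A i : A i i = 1.
Proof. by rewrite utmxE ?eqxx. Qed.

Lemma utmx_low A (i j : 'I_n) : (j < i)%N -> A i j = 0.
Proof.
move=> ji; rewrite (utmxE _ (ltnW ji)); case: eqP => // ij.
by rewrite ij ltnn in ji.
Qed.

Lemma utmx_eqP A B : (forall i j : 'I_n, (i < j)%N -> A i j = B i j) -> A = B.
Proof.
move=> AB; apply/val_inj/matrixP => i j; have [/AB//|ji] := ltnP i j.
by have /unitriP-> // := valP A; have /unitriP-> := valP B.
Qed.

Lemma unitri1 : unitri (1%:M : 'M[rat]_n).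
Proof. by apply/unitriP => i j _; rewrite mxE. Qed.

Lemma unitriM A B : unitri (A *m B).
Proof.
apply/unitriP => i j ji; rewrite mxE (bigD1 i) //= utmx_diag mul1r.
rewrite big1 ?addr0; first by rewrite utmxE.
move=> l li; have [il|li'|/val_inj il] := ltngtP i l.
- by rewrite [X in _ * X]utmx_low ?mulr0 // (leq_ltn_trans ji).
- by rewrite utmx_low ?mul0r.
- by rewrite il eqxx in li.
Qed.

Lemma utmx_unitmx A : utval A \in unitmx.
Proof.
rewrite unitmxE -det_tr det_trig; last first.
  by apply/is_trig_mxP => i j ij; rewrite mxE utmx_low.
by rewrite big1 ?unitr1 // => i _; rewrite mxE utmx_diag.
Qed.

(** Back substitution: row i of the inverse depends only on the rows below it, whence the induction
    on a bound for n - i. *)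
Lemma unitriV A : unitri (invmx A).
Proof.
set B := invmx A; have AB : utval A *m B = 1%:M by rewrite mulmxV ?utmx_unitmx.
suff H d (i j : 'I_n) : (n - i <= d)%N -> (j <= i)%N -> B i j = (i == j)%:R.
  by apply/unitriP => i j; apply: H (leqnn _).
elim: d i j => [|d IH] i j nid ji; first by have := ltn_ord i; lia.
have := congr1 (fun M : 'M_n => M i j) AB; rewrite !mxE (bigD1 i) //=.
rewrite utmx_diag mul1r big1 ?addr0 // => l li.
have [il|li'|/val_inj il] := ltngtP i l.
- rewrite IH; [|by lia|by lia]; case: eqP => [lj|_]; last by rewrite mulr0.
  by rewrite lj ltnNge ji in il.
- by rewrite utmx_low ?mul0r.
- by rewrite il eqxx in li.
Qed.

Definition utmx_one : utmx n := UTMatrix unitri1.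
Definition utmx_mul A B : utmx n := UTMatrix (unitriM A B).
Definition utmx_inv A : utmx n := UTMatrix (unitriV A).

Lemma utmx_mulA : associative utmx_mul.
Proof. by move=> A B C; apply/val_inj/mulmxA. Qed.

Lemma utmx_mul1 : left_id utmx_one utmx_mul.
Proof. by move=> A; apply/val_inj/mul1mx. Qed.

Lemma utmx_mulr1 : right_id utmx_one utmx_mul.
Proof. by move=> A; apply/val_inj/mulmx1. Qed.

Lemma utmx_mulV : left_inverse utmx_one utmx_inv utmx_mul.
Proof. by move=> A; apply/val_inj/mulVmx/utmx_unitmx. Qed.

Lemma utmx_mulrV : right_inverse utmx_one utmx_inv utmx_mul.
Proof. by move=> A; apply/val_inj/mulmxV/utmx_unitmx. Qed.

HB.instance Definition _ := isGroup.Build (utmx n)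
  utmx_mulA utmx_mul1 utmx_mulr1 utmx_mulV utmx_mulrV.

Lemma utmxME A B : utval (A * B)%g = utval A *m utval B. Proof. by []. Qed.
Lemma utmx1E : utval 1%g = 1%:M :> 'M_n. Proof. by []. Qed.

(* Orders the entries by superdiagonals, starting from the main diagonal. *)
Definition entry_key (p : 'I_n * 'I_n) : int :=
  ((p.2 : nat)%:Z - (p.1 : nat)%:Z) * n%:Z + (p.1 : nat)%:Z.

(** The row index lies in [0, n), so it is the remainder of the key modulo n, and the superdiagonal
    is the quotient. *)
Lemma entry_key_inj : injective entry_key.
Proof.
move=> [i j] [k l]; rewrite /entry_key /= => e.
have diag : (j : nat)%:Z - (i : nat)%:Z = (l : nat)%:Z - (k : nat)%:Z.
  have [||//] := ltgtP ((j : nat)%:Z - (i : nat)%:Z) ((l : nat)%:Z - (k : nat)%:Z).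
    by have := ltn_ord i; nia.
  by have := ltn_ord k; nia.
have ik : i = k by apply: ord_inj; move: e; rewrite diag; lia.
by rewrite ik in diag *; congr pair; apply: ord_inj; lia.
Qed.

Definition utmx_lt : rel (utmx n) := fun A B =>
  `[< lex entry_key (fun x y : rat => x < y)
          (fun p => A p.1 p.2) (fun p => B p.1 p.2) >].

Definition agree_below A B (p : 'I_n * 'I_n) : Prop :=
  forall l, entry_key l < entry_key p -> A l.1 l.2 = B l.1 l.2.

(** Besides A_ij, entry (i, j) of the product involves only entries A_il with l < j, which have
    smaller keys. Hence translations preserve the first difference of two matrices. *)
Lemma agree_mulr A B C i j :
  agree_below A B (i, j) -> (A * C)%g i j - (B * C)%g i j = A i j - B i j.
Proof.
move=> AB; rewrite !mxE (bigD1 j) //= [X in _ - X](bigD1 j) //= utmx_diag !mulr1.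
rewrite opprD addrACA -[RHS]addr0; congr (_ + _).
apply/eqP; rewrite subr_eq0; apply/eqP/eq_bigr => l lj.
have [jl|lj'|/val_inj jl] := ltngtP j l.
- by rewrite (@utmx_low C l j) // !mulr0.
- by rewrite (AB (i, l)) // /entry_key /=; have := ltn_ord i; nia.
- by rewrite jl eqxx in lj.
Qed.

Lemma agree_mull A B C i j :
  agree_below A B (i, j) -> (C * A)%g i j - (C * B)%g i j = A i j - B i j.
Proof.
move=> AB; rewrite !mxE (bigD1 i) //= [X in _ - X](bigD1 i) //= utmx_diag !mul1r.
rewrite opprD addrACA -[RHS]addr0; congr (_ + _).
apply/eqP; rewrite subr_eq0; apply/eqP/eq_bigr => l li.
have [il|li'|/val_inj il] := ltngtP i l.
- by rewrite (AB (l, j)) // /entry_key /=; have := ltn_ord l; nia.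
- by rewrite (@utmx_low C i l) // !mul0r.
- by rewrite il eqxx in li.
Qed.

Lemma utmx_lt_full : full_order utmx_lt.
Proof.
split=> [A|B A C|A B|A B C].
- by apply/asboolP/lex_irr => x; apply: ltxx.
- move=> /asboolP AB /asboolP BC; apply/asboolP; apply: lex_trans AB BC.
    exact: entry_key_inj.
  by move=> x y z; apply: lt_trans.
- have total (x y : rat) : [\/ x < y, x = y | y < x].
    by case: (ltgtP x y) => ?; [apply: Or31|apply: Or33|apply: Or32].
  case: (@lex_total _ _ entry_key _ (fun p => A p.1 p.2) (fun p => B p.1 p.2) total).
  (* All keys exceed this bound, so agreement below it is vacuous. *)
  + exists (- (n * n)%:Z) => -[i j]; rewrite /entry_key /=.
    by have := ltn_ord i; nia.
  + by move=> AB; apply: Or31; apply/asboolP.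
  + move=> AB; apply: Or32; apply/val_inj/matrixP => i j.
    exact: (congr1 (fun f => f (i, j)) AB).
  + by move=> AB; apply: Or33; apply/asboolP.
- move=> /asboolP [[i j] [/= ABij AB]]; split; apply/asboolP; exists (i, j) => /=.
    split=> [|[k l] kl /=]; first by rewrite -subr_lt0 agree_mulr // subr_lt0.
    apply/eqP; rewrite -subr_eq0 agree_mulr ?subr_eq0 ?(AB (k, l)) // => p pkl.
    by apply: AB; apply: lt_trans kl.
  split=> [|[k l] kl /=]; first by rewrite -subr_lt0 agree_mull // subr_lt0.
  apply/eqP; rewrite -subr_eq0 agree_mull ?subr_eq0 ?(AB (k, l)) // => p pkl.
  by apply: AB; apply: lt_trans kl.
Qed.

End UnitriangularMatrices.

(** * Truncations, diagonal automorphisms and the corner subgroup *)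

Section Truncations.

Local Open Scope ring_scope.

Lemma unitri_ul n (A : utmx n.+1) :
  unitri (\matrix_(i < n, j < n) A (widen_ord (leqnSn n) i) (widen_ord (leqnSn n) j)).
Proof. by apply/unitriP => i j ji; rewrite mxE utmxE. Qed.

Lemma unitri_dr n (A : utmx n.+1) :
  unitri (\matrix_(i < n, j < n) A (lift ord0 i) (lift ord0 j)).
Proof.
by apply/unitriP => i j ji; rewrite mxE utmxE // (inj_eq lift_inj).
Qed.

(** By triangularity, deleting the last or the first row and column is a homomorphism. *)
Definition ul_trunc n (A : utmx n.+1) : utmx n := UTMatrix (unitri_ul A).
Definition dr_trunc n (A : utmx n.+1) : utmx n := UTMatrix (unitri_dr A).

Lemma ul_truncM n : {morph @ul_trunc n : A B / (A * B)%g}.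
Proof.
move=> A B; apply/val_inj/matrixP => i j; rewrite !mxE big_ord_recr /=.
rewrite (@utmx_low _ B ord_max) //= mulr0 addr0.
by apply: eq_bigr => l _; rewrite !mxE.
Qed.

Lemma dr_truncM n : {morph @dr_trunc n : A B / (A * B)%g}.
Proof.
move=> A B; apply/val_inj/matrixP => i j; rewrite !mxE big_ord_recl /=.
rewrite utmx_low // mul0r add0r.
by apply: eq_bigr => l _; rewrite !mxE.
Qed.

Section Scaling.

Variables (n : nat) (d : 'I_n -> rat) (d_neq0 : forall i, d i != 0).

(** The matrix is the conjugate D^-1 A D by the diagonal matrix D with entries [d]. *)
Lemma unitri_scale (A : utmx n) : unitri (\matrix_(i, j) (A i j * d j / d i)).
Proof.
apply/unitriP => i j ji; rewrite mxE utmxE //.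
by case: eqP => [->|_]; rewrite ?mul0r // mul1r divff.
Qed.

Definition scale_utmx (A : utmx n) : utmx n := UTMatrix (unitri_scale A).

Lemma scale_utmxM : {morph scale_utmx : A B / (A * B)%g}.
Proof.
move=> A B; apply/val_inj/matrixP => i j; rewrite !mxE !mulr_suml.
apply: eq_bigr => l _; rewrite !mxE.
by field; rewrite !d_neq0.
Qed.

End Scaling.

Section Corner.

Variable n : nat.
Implicit Types (q r : rat) (A : utmx n.+2).

(** Size at least 2 puts the corner off the diagonal, so that E squares to 0. *)
Let E : 'M[rat]_n.+2 := delta_mx ord0 ord_max.

Lemma unitri_corner q : unitri (1%:M + q *: E).
Proof.
apply/unitriP => i j ji; rewrite !mxE; case: (i =P ord0) => [i0|_] /=.
  case: (j =P ord_max) => [jm|_]; last by rewrite mulr0 addr0.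
  by rewrite i0 jm in ji.
by rewrite mulr0 addr0.
Qed.

Definition corner q : utmx n.+2 := UTMatrix (unitri_corner q).

Lemma cornerE q i j :
  corner q i j = (i == j)%:R + q * ((i == ord0) && (j == ord_max))%:R.
Proof. by rewrite !mxE. Qed.

Lemma corner_max q : corner q ord0 ord_max = q.
Proof. by rewrite cornerE !eqxx mulr1 add0r. Qed.

Lemma cornerD q r : corner (q + r) = (corner q * corner r)%g.
Proof.
apply/val_inj; rewrite /= mulmxDl mul1mx mulmxDr mulmx1.
rewrite -scalemxAl -scalemxAr mul_delta_mx_0 // !scaler0 addr0.
by rewrite scalerDl addrAC addrA.
Qed.

Lemma corner_inj : injective corner.
Proof.
by move=> q r /(congr1 (fun A : utmx _ => A ord0 ord_max)); rewrite !corner_max.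
Qed.

(** The last row and the first column of A are those of the identity, so EA = E = AE. *)
Lemma corner_central q A : commute (corner q) A.
Proof.
apply/val_inj; rewrite /= mulmxDl mulmxDr mul1mx mulmx1.
congr (_ + _); rewrite -scalemxAl -scalemxAr; congr (_ *: _).
apply/matrixP => i j; rewrite !mxE [LHS](bigD1 ord_max) //= [RHS](bigD1 ord0) //=.
rewrite !big1 ?addr0 => [|l l0|l lm]; last first.
- by rewrite mxE (negPf lm) andbF mul0r.
- by rewrite mxE (negPf l0) mulr0.
rewrite !mxE !eqxx andbT.
case: (j =P ord_max) => [->|/eqP jm]; last first.
  by rewrite (@utmxE _ A ord_max j) ?leq_ord // [ord_max == j]eq_sym (negPf jm) !mulr0.
by rewrite utmx_diag (@utmxE _ A i ord0) // !mulr1.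
Qed.

Lemma corner_lt q r : utmx_lt (corner q) (corner r) <-> q < r.
Proof.
have off p : p != (ord0, ord_max) -> corner q p.1 p.2 = corner r p.1 p.2.
  case: p => i j; rewrite xpair_eqE !cornerE /= => /negPf->.
  by rewrite !mulr0.
split=> [/asboolP [k [+ _]]|qr].
  have [->|/off->] := eqVneq k (ord0, ord_max); last by rewrite ltxx.
  by rewrite !corner_max.
apply/asboolP; exists (ord0, ord_max); rewrite !corner_max; split=> // l lt_l.
by apply: off; apply: contraTneq lt_l => ->; rewrite ltxx.
Qed.

(** Each entry above the diagonal, except the corner, survives in one of the two truncations. *)
Lemma utmx_corner A :
  ul_trunc A = 1%g -> dr_trunc A = 1%g -> A = corner (A ord0 ord_max).
Proof.
move=> ul1 dr1; apply: utmx_eqP => i j ij.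
rewrite cornerE -val_eqE /= (ltn_eqF ij) add0r.
case: (unliftP ord0 i) => [i' iE|i0]; last first.
  case: (unliftP ord_max j) => [j' jE|->]; last by rewrite i0 !eqxx mulr1.
  have := congr1 (fun B : utmx n.+1 => B ord0 j') ul1; rewrite !mxE.
  rewrite (_ : widen_ord _ ord0 = i); last by apply: ord_inj; rewrite i0.
  have jE' : widen_ord (leqnSn n.+1) j' = j.
    by apply: ord_inj; rewrite jE lift_max.
  rewrite jE' => ->; rewrite [j == _]eq_sym jE (negPf (neq_lift _ _)) andbF mulr0.
  case: eqP => // j0; have := congr1 val jE'.
  by rewrite -j0 /= => j0'; rewrite i0 -j0' ltnn in ij.
case: (unliftP ord0 j) => [j' jE|j0]; last by rewrite j0 in ij.
have := congr1 (fun B : utmx n.+1 => B i' j') dr1; rewrite !mxE -iE -jE => ->.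
have /negPf-> : i' != j'.
  by apply: contraTneq ij => e; rewrite iE jE e ltnn.
by rewrite iE /= mulr0.
Qed.

End Corner.

End Truncations.

(** * Nontrivial values at commutators *)

Section BandMatrices.

Local Open Scope ring_scope.
Variable n : nat.
Implicit Types (d e : nat) (P Q : pred nat) (c : rat).

Definition band d P : 'M[rat]_n := \matrix_(i, j) ((j == i + d :> nat)%N && P i)%:R.

Lemma bandM d e P Q :
  band d P *m band e Q = band (d + e) (fun i => P i && Q (i + d)%N).
Proof.
apply/matrixP => i j; rewrite !mxE.
have [idn|nid] := ltnP (i + d)%N n; last first.
  have /negPf-> : j != (i + (d + e))%N :> nat by have := ltn_ord j; lia.
  rewrite big1 // => l _; rewrite !mxE.
  have /negPf-> : l != (i + d)%N :> nat by have := ltn_ord l; lia.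
  by rewrite mul0r.
rewrite (bigD1 (Ordinal idn)) //= !mxE big1 ?addr0 => [|l /negPf lid].
  by rewrite /= eqxx addnA -natrM mulnb; case: (_ == _); rewrite ?andbT ?andbF.
by rewrite mxE -[_ == _ :> nat]/(l == Ordinal idn) lid mul0r.
Qed.

Lemma band0 d P :
  (forall i, (i + d < n)%N -> P i = false) -> band d P = 0.
Proof.
move=> P0; apply/matrixP => i j; rewrite !mxE.
by case: eqP => //= jE; rewrite P0 // -jE.
Qed.

Lemma unitri_band d P c : (0 < d)%N -> unitri (1%:M + c *: band d P).
Proof.
move=> d_gt0; apply/unitriP => i j ji; rewrite !mxE.
by rewrite [_ == (_ + _)%N]ltn_eqF ?mulr0 ?addr0 //; lia.
Qed.

(** The band has offset [d.+1], so the diagonal stays untouched. *)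
Definition uniband d P c : utmx n := UTMatrix (unitri_band P c (ltn0Sn d)).

End BandMatrices.

(** * A nontrivial value built along the syllables of a word *)

Section CommutatorPlacement.

Local Open Scope ring_scope.
Local Open Scope group_scope.
Variable ss : seq syllable.
Hypothesis ss_alt : alternating ss.
Let k := size ss.
(** Syllable p leads from index 2p through 2p+1 to 2p+2; the last index is 2k. *)
Let n := k.*2.+1.
(** The default label at p = k is harmless, as the last row has nothing right of the diagonal. *)
Let lab (p : nat) : nat := (nth ((0, false), 0) ss p).1.1.

Lemma lab_alternating p : (p.+1 < k)%N -> lab p != lab p.+1.
Proof. by move=> pk; apply: (sortedP ((0, false), 0) ss_alt). Qed.

Let at_even i : pred nat := fun a => ~~ odd a && (lab a./2 == i).
Let at_odd i : pred nat := fun a => odd a && (lab a./2 == i).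

(* The syllable [p] of label [i] contributes the entry (2p, 2p+1) to [left_gen i],
   (2p+1, 2p+2) to [right_gen i] and (2p, 2p+2) to [chain i c]. *)
Definition left_gen (i : nat) : utmx n := uniband n 0 (at_even i) 1.
Definition right_gen (i : nat) : utmx n := uniband n 0 (at_odd i) 1.
Definition chain i (c : rat) : utmx n := uniband n 1 (at_even i) c.

(** The band squares to 0: a nonzero product would need consecutive syllables with the same
    label. *)
Lemma chainD i c c' : chain i (c + c')%R = chain i c * chain i c'.
Proof.
have ZZ : band n 2 (at_even i) *m band n 2 (at_even i) = 0%R.
  rewrite bandM band0 // => a an; apply/negbTE/negP.
  case/andP=> /andP[_ /eqP la] /andP[_]; rewrite addn2 /= -la eq_sym.
  by apply/negP/lab_alternating; rewrite /n in an; lia.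
apply/val_inj => /=; rewrite mulmxDl mul1mx mulmxDr mulmx1 -scalemxAl -scalemxAr.
by rewrite ZZ !scaler0 addr0 scalerDl addrAC addrA.
Qed.

(** With YX = 0, again because labels alternate, the claim becomes (1 + Y)(1 + X)(1 + Z) = (1 + X)(1
    + Y), where Z = XY. *)
Lemma chain_commutator i : chain i 1 = [~ left_gen i, right_gen i].
Proof.
apply: (mulgI (right_gen i * left_gen i)); rewrite -commgC; apply/val_inj => /=.
rewrite !scale1r; set X := band n 1 (at_even i).
set Y := band n 1 (at_odd i); set Z := band n 2 (at_even i).
have YX : Y *m X = 0%R.
  rewrite bandM band0 // => a an; apply/negbTE/negP.
  case/andP=> /andP[oa /eqP la] /andP[_]; rewrite addn1 -la.
  rewrite (_ : a.+1./2 = a./2.+1); last by lia.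
  by rewrite eq_sym; apply/negP/lab_alternating; rewrite /n in an; lia.
have XX : X *m X = 0%R.
  rewrite bandM band0 // => a _; rewrite /at_even addn1 /=.
  by case: (odd a); rewrite ?andbF.
have XY : X *m Y = Z.
  rewrite bandM; apply/matrixP => a b; rewrite !mxE; congr ((_ && _)%:R)%R.
  rewrite /at_even /at_odd addn1 /=.
  by case oa: (odd a); rewrite //= uphalf_half oa andbb.
have XZ : X *m Z = 0%R by rewrite -XY mulmxA XX mul0mx.
have YZ : Y *m Z = 0%R by rewrite -XY mulmxA YX mul0mx.
rewrite !(mulmxDl, mulmxDr, mul1mx, mulmx1) YX XY XZ YZ !mul0mx !addr0.
by rewrite -!addrA; congr (_ + _)%R; rewrite addrCA.
Qed.

Lemma chain0 i : chain i 0 = 1.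
Proof. by apply: (mulgI (chain i 0)); rewrite -chainD addr0 mulg1. Qed.

Lemma chainV i c : (chain i c)^-1 = chain i (- c)%R.
Proof. by apply: (mulgI (chain i c)); rewrite mulgV -chainD subrr chain0. Qed.

Lemma chainX i c m : chain i c ^+ m = chain i (c * m%:R)%R.
Proof.
elim: m => [|m IH]; first by rewrite mulr0 chain0.
by rewrite expgS IH -chainD mulrS mulrDr mulr1.
Qed.

Let exponent (s : syllable) : rat := ((if s.1.2 then -1 else 1) * s.2.+1%:R)%R.

Lemma chain_syllable s :
  syllable_value (chain^~ 1%R) s = chain s.1.1 (exponent s).
Proof.
by case: s => -[i []] m; rewrite /syllable_value /letter_value /= ?chainV chainX.
Qed.

(* A syllable moves entries of row 0 two columns to the right at most, and
   column 2s+2 can only be reached from column 2s. *)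
Lemma chain_row s : (s <= k)%N ->
  let P := \prod_(t <- take s ss) syllable_value (chain^~ 1%R) t in
  (forall j : 'I_n, (s.*2 < j)%N -> P ord0 j = 0%R) /\
  (forall j : 'I_n, j = s.*2 :> nat -> P ord0 j != 0%R).
Proof.
elim: s => [|s IH] sk.
  rewrite take0 big_nil; split=> j j0; rewrite utmx1E mxE.
    by case: eqP => // e; rewrite -e in j0.
  by rewrite (_ : ord0 = j) ?eqxx ?oner_eq0 //; apply: ord_inj.
have [lo nz] := IH (ltnW sk).
rewrite (take_nth ((0, false), 0)) // big_rcons /=.
set P := \prod_(t <- _) _ in lo nz *; set t := nth _ _ _.
(* Row 0 of P vanishes in these columns, so only the band part of the new factor contributes. *)
have next (j : 'I_n) : (s.*2.+2 <= j)%N ->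
    (P * syllable_value (chain^~ 1%R) t)%g ord0 j =
    (\sum_(l < n) P ord0 l *
       (exponent t * ((j == l + 2 :> nat)%N && at_even t.1.1 l)%:R))%R.
  move=> sj; rewrite chain_syllable utmxME /= mulmxDr mulmx1 !mxE lo ?add0r.
    by apply: eq_bigr => l _; rewrite !mxE.
  by lia.
split=> j; rewrite doubleS => sj; rewrite next; [|by lia| |by lia].
  rewrite big1 // => l _; case: eqP => [jl|_]; last by rewrite !mulr0.
  by rewrite lo ?mul0r //; lia.
have sn : (s.*2 < n)%N by rewrite /n; lia.
rewrite (bigD1 (Ordinal sn)) //= big1 ?addr0 => [|l ls].
  rewrite sj addn2 eqxx /at_even odd_double doubleK /= /t /lab eqxx mulr1.
  (* Characteristic 0 keeps the exponent nonzero. *)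
  rewrite mulf_neq0 ?nz // /exponent mulf_neq0 ?pnatr_eq0 //.
  by case: ifP; rewrite ?oppr_eq0 oner_eq0.
case: eqP => [jl|_]; last by rewrite !mulr0.
case/negP: ls; apply/eqP/ord_inj => /=; lia.
Qed.

(** The entry (0, 2k) is nonzero, and it lies off the diagonal since k > 0. *)
Lemma chain_value_neq1 :
  ss != [::] -> \prod_(t <- ss) syllable_value (chain^~ 1%R) t != 1.
Proof.
move=> ss0; have [_ nz] := chain_row (leqnn k).
rewrite take_size in nz; apply/eqP => P1.
have := nz ord_max erefl; rewrite P1 utmx1E mxE.
case: (ord0 =P ord_max) => [/(congr1 val) /= k0|_ /eqP //].
by move/eqP: ss0 => ss0 _; apply: ss0; apply: size0nil; rewrite -/k; lia.
Qed.

End CommutatorPlacement.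

(** * Commutator values filling the corner *)

Section CornerValues.

Local Open Scope ring_scope.

Definition commutator_value n (v : free_inf) (g h : nat -> utmx n) : utmx n :=
  word_value (fun i => [~ g i, h i])%g v.

Lemma commutator_value_morphism m n (f : utmx m -> utmx n) v g h :
    {morph f : x y / (x * y)%g} ->
  f (commutator_value v g h) = commutator_value v (f \o g) (f \o h).
Proof.
move=> fM; rewrite /commutator_value (morphism_word_value fM).
by congr word_value; apply/funext => i /=; rewrite morphismR.
Qed.

Lemma commutator_value_neq1 v : freeval v <> [::] ->
  exists n (g h : nat -> utmx n), commutator_value v g h <> 1%g.
Proof.
move=> v0; have alt := syllables_alternating (valP v).
exists (size (syllables v)).*2.+1, (left_gen (syllables v)), (right_gen (syllables v)).
apply/eqP; rewrite /commutator_value (_ : (fun i => _) = (chain (syllables v))^~ 1).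
  rewrite /word_value -prod_syllables; apply: chain_value_neq1 => //.
  by apply/eqP => /syllables_nil.
by apply/funext => i; rewrite chain_commutator.
Qed.

(* In the least dimension where the value of [v] on commutators is not
   identically 1, both truncations of every value are trivial, hence every value
   lies in the corner; diagonal automorphisms rescale it at will. *)
Lemma corner_commutator_value v : freeval v <> [::] ->
  exists n, forall q, q != 0 -> exists g h : nat -> utmx n.+2,
    commutator_value v g h = corner n q.
Proof.
move=> v0; pose P n := `[< exists g h : nat -> utmx n, commutator_value v g h <> 1%g >].
have exP : exists n, P n.
  by have [n ?] := commutator_value_neq1 v0; exists n; apply/asboolP.
case: (ex_minnP exP) => n /asboolP [g [h gh]] minn.
have trivial m g' h' : (m < n)%N -> @commutator_value m v g' h' = 1%g.
  move=> mn; apply: contrapT => gh'; have /minn : P m; last by lia.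
  by apply/asboolP; exists g', h'.
(* In dimensions 0 and 1 the group is trivial, so the least dimension is at least 2. *)
case: n => [|[|n]] in g h gh {minn} trivial *.
- by case: gh; apply: utmx_eqP => -[].
- by case: gh; apply: utmx_eqP => i j; rewrite !ord1.
exists n => q q0; set A := commutator_value v g h in gh.
have AE : A = corner n (A ord0 ord_max).
  apply: utmx_corner; rewrite commutator_value_morphism ?trivial //.
    exact: ul_truncM.
  exact: dr_truncM.
set c := A ord0 ord_max in AE; have c0 : c != 0.
  apply/eqP => c0; apply: gh; rewrite AE c0.
  by apply: utmx_eqP => i j _; rewrite cornerE mul0r addr0 mxE.
(* Scaling divides the corner entry c by c / q. *)
pose d (i : 'I_n.+2) := if i == ord0 then c / q else 1.
have d0 i : d i != 0.
  by rewrite /d; case: ifP => _; rewrite ?oner_eq0 // mulf_neq0 ?invr_eq0.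
exists (scale_utmx d0 \o g), (scale_utmx d0 \o h).
rewrite -commutator_value_morphism; last exact: scale_utmxM.
rewrite -/A AE; apply: utmx_eqP => i j ij.
rewrite mxE !cornerE -val_eqE /= (ltn_eqF ij) !add0r.
case: (i =P ord0) => [->|_] /=; last by rewrite !mulr0 !mul0r.
case: (j =P ord_max) => [->|_]; last by rewrite !mulr0 !mul0r.
by rewrite /d /= invf_div !mulr1 mulrC mulfVK.
Qed.

End CornerValues.

(** * Two-generator subgroups of a wreath product *)

Section GeneratedGroups.

Local Open Scope group_scope.
Variables (W : groupType) (A : set W).

Definition gengroup : Type := {x : W | x \in generated A}.

HB.instance Definition _ := SubChoice.on gengroup.

Lemma generated_closed : group_closed (fun x => x \in generated A).
Proof. exact: (generated_subgroup A). Qed.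

HB.instance Definition _ := SubChoice_isSubGroup.Build W
  (fun x => x \in generated A) gengroup generated_closed.

Definition gval (x : gengroup) : W := val x.

Lemma gval_inj : injective gval. Proof. exact: val_inj. Qed.

Lemma gvalM : {morph gval : x y / x * y}. Proof. exact: valM. Qed.

Lemma gvalP (x : gengroup) : generated A (gval x).
Proof. exact: set_mem (valP x). Qed.

Definition in_gengroup (x : W) (gx : generated A x) : gengroup :=
  Sub x (mem_set gx).

Lemma in_gengroupK (x : W) (gx : generated A x) : gval (in_gengroup gx) = x.
Proof. exact: SubK. Qed.

(** The image in [W] of a subgroup containing the generators is a subgroup containing [A], hence all
    of [generated A]. *)
Lemma generated_gengroup : generated [set x | A (gval x)] = [set: gengroup].
Proof.
apply/seteqP; split=> // x _ B [sB AB].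
have sub : subgroup [set w | exists2 y, B y & gval y = w].
  apply/subgroupP; split=> [|_ _ [x' Bx <-] [y' By <-]].
    by exists 1; [apply: subgroup1|apply: morphism1 gvalM].
  exists (x' / y'); first exact: subgroupF.
  by rewrite gvalM (morphismV gvalM).
have [|y By /gval_inj<- //] := generated_min sub _ (gvalP x).
move=> w Aw; have gw : generated A w by apply: sub_generated.
by exists (in_gengroup gw); [apply: AB|]; rewrite /= in_gengroupK.
Qed.

End GeneratedGroups.

Lemma gengroup_two_generator (W : groupType) (a b : W) :
  two_generator (gengroup [set a; b]).
Proof.
have ga : generated [set a; b] a by apply: sub_generated; left.
have gb : generated [set a; b] b by apply: sub_generated; right.
exists (in_gengroup ga), (in_gengroup gb).
rewrite -generated_gengroup; congr generated; apply/seteqP; split=> x /=.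
  by case=> ->; rewrite in_gengroupK; [left|right].
by case=> xE; [left|right]; apply: gval_inj; rewrite in_gengroupK.
Qed.

(** * The ordered wreath product with the integers *)

Section WreathProduct.

Local Open Scope ring_scope.
Local Open Scope group_scope.

(* The unrestricted wreath product of [K] and the integers; [(f, m)] is the
   element [f] of the base followed by [m] shifts. *)
Definition wreath (K : groupType) : Type := ((int -> K) * int)%type.

Variable K : groupType.
Implicit Types x y z : wreath K.

HB.instance Definition _ := Choice.copy (wreath K) ((int -> K) * int)%type.

Definition wr_one : wreath K := (fun=> 1, 0%R).
Definition wr_mul x y : wreath K :=
  (fun p => x.1 p * y.1 (p - x.2)%R, (x.2 + y.2)%R).
Definition wr_inv x : wreath K := (fun p => (x.1 (p + x.2)%R)^-1, (- x.2)%R).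

Lemma wr_eqP x y : x.1 =1 y.1 -> x.2 = y.2 -> x = y.
Proof. by case: x y => f m [g p] /= /funext-> ->. Qed.

Lemma wr_mulA : associative wr_mul.
Proof.
move=> x y z; apply: wr_eqP => [p|] /=; last by rewrite addrA.
by rewrite mulgA opprD addrA.
Qed.

Lemma wr_mul1 : left_id wr_one wr_mul.
Proof. by move=> x; apply: wr_eqP => [p|] /=; rewrite ?add0r // subr0 mul1g. Qed.

Lemma wr_mulr1 : right_id wr_one wr_mul.
Proof. by move=> x; apply: wr_eqP => [p|] /=; rewrite ?addr0 // mulg1. Qed.

Lemma wr_mulV : left_inverse wr_one wr_inv wr_mul.
Proof.
by move=> x; apply: wr_eqP => [p|] /=; rewrite ?addNr // opprK mulVg.
Qed.

Lemma wr_mulrV : right_inverse wr_one wr_inv wr_mul.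
Proof.
by move=> x; apply: wr_eqP => [p|] /=; rewrite ?subrr // subrK mulgV.
Qed.

HB.instance Definition _ := isGroup.Build (wreath K)
  wr_mulA wr_mul1 wr_mulr1 wr_mulV wr_mulrV.

(** Ensures a first position of difference, hence totality of the order. *)
Definition bounded_below : set (wreath K) :=
  [set x | exists b, forall p, (p < b)%R -> x.1 p = 1].

Lemma bounded_below_subgroup : subgroup bounded_below.
Proof.
apply/subgroupP; split=> [|x y [b xb] [c yc]]; first by exists 0%R.
(* The base part of x / y at p involves that of y at p - x.2 + y.2. *)
exists (Num.min b (c + x.2 - y.2)%R) => p; rewrite lt_min => /andP[pb pc] /=.
by rewrite xb // yc ?invg1 ?mulg1 //; lia.
Qed.

Section Order.

Variables (ltK : rel K) (ltK_full : full_order ltK).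

Definition wr_lt : rel (wreath K) := fun x y =>
  `[< (x.2 < y.2)%R \/ x.2 = y.2 /\ lex id ltK x.1 y.1 >].

Lemma wr_lt_irr : irreflexive wr_lt.
Proof.
case: ltK_full => irr _ _ _ x; apply/asboolP; rewrite ltxx.
by case=> // -[_]; apply: lex_irr.
Qed.

Lemma wr_lt_trans : transitive wr_lt.
Proof.
case: ltK_full => _ tr _ _ y x z /asboolP xy /asboolP yz; apply/asboolP.
case: xy yz => [xy|[-> xy]] [yz|[<- yz]]; try by left.
  by left; apply: lt_trans yz.
by right; split=> //; apply: lex_trans yz.
Qed.

Lemma wr_lt_total x y : bounded_below x -> bounded_below y ->
  [\/ wr_lt x y, x = y | wr_lt y x].
Proof.
case: ltK_full => _ _ total _ [b xb] [c yc].
have [xy|yx|xy] := ltgtP x.2 y.2.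
- by apply: Or31; apply/asboolP; left.
- by apply: Or33; apply/asboolP; left.
case: (@lex_total _ _ id _ x.1 y.1 total) => [|||].
- exists (Num.min b c) => p; rewrite lt_min => /andP[pb pc].
  by rewrite xb // yc.
- by move=> lexy; apply: Or31; apply/asboolP; right.
- by move=> fE; apply: Or32; apply: wr_eqP => // p; rewrite fE.
- by move=> lexy; apply: Or33; apply/asboolP; right.
Qed.

Lemma wr_lt_mul x y z : wr_lt x y -> wr_lt (x * z) (y * z) /\ wr_lt (z * x) (z * y).
Proof.
case: ltK_full => _ _ _ inv.
case/asboolP=> [xy|[xy [p [ltp eqp]]]].
  by split; apply/asboolP; left; rewrite /= (ltrD2r, ltrD2l).
split; apply/asboolP; right; split=> /=; rewrite ?xy //.
  exists p; split=> [|q qp]; first by case: (inv _ _ (z.1 (p - y.2)%R) ltp).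
  by rewrite eqp.
(* Left multiplication by z moves the first difference by z.2. *)
exists (p + z.2)%R; rewrite addrK; split=> [|q qp].
  by case: (inv _ _ (z.1 (p + z.2)%R) ltp).
by rewrite eqp //=; lia.
Qed.

Variables (A : set (wreath K)) (A_bounded : A `<=` bounded_below).

Definition gen_lt : rel (gengroup A) :=
  fun u v => wr_lt (gval u) (gval v).

Lemma gen_lt_full : full_order gen_lt.
Proof.
have bounded (u : gengroup A) : bounded_below (gval u).
  exact: (generated_min bounded_below_subgroup A_bounded (gvalP u)).
split=> [u|v u w|u v|u v w]; first exact: wr_lt_irr.
- exact: wr_lt_trans.
- have [xy|/gval_inj xy|xy] := wr_lt_total (bounded u) (bounded v).
  + exact: Or31.
  + exact: Or32.
  + exact: Or33.
- by move=> /wr_lt_mul; rewrite /gen_lt !gvalM.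
Qed.

End Order.

Definition base (f : int -> K) : wreath K := (f, 0%R).

Lemma baseR f g : base (fun p => [~ f p, g p]) = [~ base f, base g].
Proof.
by apply: wr_eqP => [p|]; rewrite /= !(oppr0, addr0).
Qed.

Definition at_zero (k : K) : wreath K := base (fun p => if p == 0%R then k else 1).

Lemma at_zeroM : {morph at_zero : k l / k * l}.
Proof.
move=> k l; apply: wr_eqP => [p|] /=; last by rewrite addr0.
by rewrite subr0; case: eqP; rewrite ?mulg1.
Qed.

Lemma at_zero_inj : injective at_zero.
Proof. by move=> k l /(congr1 (fun x : wreath K => x.1 0%R)). Qed.

Lemma at_zero_central k x :
  (forall l, commute k l) -> x.2 = 0%R -> commute (at_zero k) x.
Proof.
move=> kC x0; apply: wr_eqP => [p|] /=; last by rewrite x0.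
by rewrite x0 !subr0; case: eqP => _; [apply: kC|rewrite mul1g mulg1].
Qed.

Lemma at_zero_lt ltK k l : full_order ltK ->
  wr_lt ltK (at_zero k) (at_zero l) <-> ltK k l.
Proof.
case=> irr _ _ _; split=> [/asboolP|kl].
  by case=> [|[_ [p [+ _]]]]; rewrite /= ?ltxx //; case: eqP => // _; rewrite irr.
apply/asboolP; right; split=> //; exists 0%R => /=; split=> // p p0.
by rewrite lt_eqF.
Qed.

Variables (code : K -> nat) (code_inj : injective code).

Definition spread (p : int) : K := xget 1 [set k | p = (2 ^ code k)%N].
Definition shift : wreath K := (fun=> 1, 1%R).

Lemma spreadE k : spread (2 ^ code k)%N = k.
Proof.
rewrite /spread; case: xgetP => [l _ /= kl|/(_ k) /= []//].
by apply/code_inj/(@expnI 2) => //; lia.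
Qed.

Lemma spread_support p : spread p <> 1 -> exists k, p = (2 ^ code k)%N.
Proof. by rewrite /spread; case: xgetP => // k _ pk _; exists k. Qed.

Lemma shiftX m : shift ^+ m = (fun=> 1, m%:Z) :> wreath K.
Proof.
elim: m => // m IH; rewrite expgS IH; apply: wr_eqP => [p|] /=; first exact: mulg1.
by lia.
Qed.

Lemma base_shift f m : base f ^ (shift ^+ m) = base (fun p => f (p + m%:Z)%R).
Proof.
rewrite shiftX; apply: wr_eqP => [p|] /=; last by lia.
by rewrite mulg1 invg1 mul1g opprK.
Qed.

(** The powers of 2 form a Sidon set: a sum of two of them determines the larger exponent, then the
    other. *)
Lemma sidon_exp2 a b c d : (2 ^ a + 2 ^ b = 2 ^ c + 2 ^ d)%N -> a = c \/ a = d.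
Proof.
(* If t < v, then 2^w + 2^t <= 2^(t+1) <= 2^v < 2^u + 2^v. *)
have max_eq u v w t : (u <= v)%N -> (w <= t)%N ->
    (2 ^ u + 2 ^ v = 2 ^ w + 2 ^ t)%N -> (v <= t)%N.
  move=> uv wt e; rewrite leqNgt; apply/negP => tv.
  have := leq_pexp2l (isT : 0 < 2)%N wt; have := leq_pexp2l (isT : 0 < 2)%N tv.
  by rewrite expnS; have := expn_gt0 2 u; lia.
wlog cd : c d / (c <= d)%N => [H|].
  have [/H//|/ltnW /H {}H] := leqP c d.
  by rewrite [(2 ^ c + _)%N]addnC => /H [->|->]; [right|left].
have [ab|/ltnW ba] := leqP a b => e.
  have bd : b = d.
    by apply/eqP; rewrite eqn_leq (max_eq _ _ _ _ ab cd e) (max_eq _ _ _ _ cd ab).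
  by left; apply: (@expnI 2) => //; move: e; rewrite bd => /addIn.
right; apply/eqP; rewrite addnC in e.
by rewrite eqn_leq (max_eq _ _ _ _ ba cd e) (max_eq _ _ _ _ cd ba).
Qed.

Lemma at_zero_commutator k l :
  generated [set base spread; shift] (at_zero [~ k, l]).
Proof.
set S := generated _; have sS : subgroup S by apply: generated_subgroup.
(* The Sidon argument needs k and l distinct. *)
have [->|kl] := pselect (k = l).
  rewrite commgg (_ : at_zero 1 = 1); first exact: subgroup1.
  by apply: wr_eqP => //= p; rewrite if_same.
suff -> : at_zero [~ k, l] =
    [~ base spread ^ (shift ^+ (2 ^ code k)), base spread ^ (shift ^+ (2 ^ code l))].
  have Sspread : S (base spread) by apply: sub_generated; left.
  have Sshift : S shift by apply: sub_generated; right.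
  by apply: (subgroupR sS); apply: (subgroupJ sS) => //; apply: (subgroupX _ sS).
rewrite !base_shift -baseR /at_zero; congr base; apply/funext => p.
case: eqP => [->|p0]; first by rewrite !add0r !spreadE.
apply/esym.
have [->|/spread_support [u pu]] := pselect (spread (p + (2 ^ code k)%N)%R = 1).
  exact: comm1g.
have [->|/spread_support [w pw]] := pselect (spread (p + (2 ^ code l)%N)%R = 1).
  exact: commg1.
(* Both entries are nontrivial at p only if 2^[code u] - 2^[code k] = p = 2^[code w] - 2^[code l],
   which forces k = l or p = 0. *)
have /sidon_exp2 : (2 ^ code k + 2 ^ code w = 2 ^ code l + 2 ^ code u)%N by lia.
case=> [/code_inj //|/code_inj ku].
by case: p0; rewrite -ku in pu; lia.
Qed.

End WreathProduct.

(** * The two-generator group and its verbal and subnormal subgroups *)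

Section TwoGeneratorEnvelope.

Local Open Scope group_scope.
Variables (K : groupType) (code : K -> nat) (code_inj : injective code).
Variables (ltK : rel K) (ltK_full : full_order ltK).

Definition envelope_gens : set (wreath K) := [set base (spread code); @shift K].

Local Notation envelope := (gengroup envelope_gens).

Definition envelope_lt : rel envelope := @gen_lt K ltK _.

Lemma envelope_lt_full : full_order envelope_lt.
Proof.
apply: (gen_lt_full ltK_full) => x /= [->|->]; last by exists 0%R.
exists 0%R => p p0 /=; apply: contrapT => /spread_support [k pk].
by rewrite pk in p0.
Qed.

(** The commutators themselves, placed at 0, belong to the group and may be substituted into [v]. *)
Lemma commutator_value_in_envelope (V : set free_inf) v (g h : nat -> K) : V v ->
  exists2 y : envelope, verbal envelope V y &
    gval y = at_zero (word_value (fun i => [~ g i, h i]) v).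
Proof.
move=> Vv; pose c i : envelope := in_gengroup (at_zero_commutator code_inj (g i) (h i)).
exists (word_value c v); first by apply: sub_generated; exists v => //; exists c.
rewrite (morphism_word_value (@at_zeroM K)) (morphism_word_value (@gvalM _ _)).
by congr word_value; apply/funext => i; rewrite /= in_gengroupK.
Qed.

(** The series is Z, B, G: the base part B is the kernel of the projection to the integers and
    centralises Z. *)
Lemma central_subnormal (Z : set envelope) : subgroup Z ->
    (forall z, Z z -> exists2 k, forall l, commute k l & gval z = at_zero k) ->
  subnormal Z.
Proof.
move=> sZ Zcentral; split=> //.
pose B : set envelope := [set x : envelope | (gval x).2 = 0%R].
have sB : subgroup B.
  apply/subgroupP; split=> [|x y x0 y0].
    by rewrite /B /mkset (morphism1 (@gvalM _ _)).
  by rewrite /B /mkset gvalM (morphismV (@gvalM _ _)) /= x0 y0 oppr0 addr0.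
exists 2, (fun i => if i is 0 then Z else if i is 1 then B else setT).
split=> // -[|[|//]] _; split=> //.
- by move=> z /Zcentral [k _ zE]; rewrite /B /= zE.
- move=> z x Zz Bx; rewrite (_ : z ^ x = z) //; apply/conjg_fixP/commgP.
  have [k kC zE] := Zcentral z Zz; apply: gval_inj; rewrite !gvalM zE.
  exact: at_zero_central.
- by apply/subgroupP.
- move=> x y x0 _; rewrite /B /mkset /conjg !gvalM (morphismV (@gvalM _ _)) /= x0.
  by rewrite add0r addNr.
Qed.

End TwoGeneratorEnvelope.

(** * The embedding of the rationals *)

Theorem theorem2 (V : set free_inf) (hV : nontrivial_word_set V) :
  exists (G : groupType) (lt : rel G) (Phi : {multiplicative ratgroup -> G}),
    [/\ two_generator G,
        full_order lt,
        injective Phi,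
        order_preserving Phi rat_lt lt &
        subnormal_embedding Phi /\ verbal_embedding Phi V].
Proof.
have [v Vv v0] := nontrivial_word hV.
have [n cornerV] := corner_commutator_value v0.
have code_inj := pcan_inj (@pickleK (utmx n.+2)).
pose G : groupType := gengroup (envelope_gens (@pickle (utmx n.+2))).
have exPhi (q : ratgroup) :
    exists y : G, verbal G V y /\ gval y = at_zero (corner n q).
  (* Corner values are available for nonzero q only; 0 goes to the identity. *)
  have [->|/cornerV [g [h <-]]] := eqVneq (q : rat) 0%R; last first.
    by have [y Vy yE] := commutator_value_in_envelope code_inj g h Vv; exists y.
  exists 1%g; split; first by apply: subgroup1; apply: generated_subgroup.
  apply: (mulgI (at_zero (corner n 0%R))).
  by rewrite -at_zeroM -cornerD addr0 (morphism1 (@gvalM _ _)) mulg1.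
(* As [gval] is injective, the chosen element is determined by q, so the pointwise choice is a
   homomorphism. *)
have [Phi PhiP] := choice exPhi.
have PhiE q : gval (Phi q) = at_zero (corner n q) by case: (PhiP q).
have PhiM : {morph Phi : p q / (p * q)%g}.
  by move=> p q; apply: gval_inj; rewrite gvalM !PhiE -at_zeroM -cornerD.
pose PhiMul := isMultiplicative.Build ratgroup G Phi PhiM.
pose F : {multiplicative ratgroup -> G} := HB.pack Phi PhiMul.
exists G, (@envelope_lt _ _ (@utmx_lt n.+2)), F; split.
- exact: gengroup_two_generator.
- exact: (envelope_lt_full _ (@utmx_lt_full _)).
- by move=> p q /(congr1 (@gval _ _)); rewrite !PhiE => /at_zero_inj/corner_inj.
- move=> p q; rewrite /envelope_lt /gen_lt !PhiE.
  by rewrite (at_zero_lt _ _ (@utmx_lt_full _)) corner_lt.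
- split; last by move=> _ [q _ <-]; case: (PhiP q).
  apply: central_subnormal => [|_ [q _ <-]]; last first.
    by exists (corner n q) => //; apply: corner_central.
  apply/subgroupP; split=> [|_ _ [p _ <-] [q _ <-]].
    by exists 1%g => //; apply: (morphism1 PhiM).
  by exists (p / q)%g => //; rewrite /= PhiM (morphismV PhiM).
Qed.
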